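(* For $d\ge1$ let $\mathbf{C}_d\subset\mathbb{R}^d$ be the classical root polytope of type C, i.e. the convex hull of $$\{\pm e_i : 1\le i\le d\}\cup\{\pm(e_i+\cdots+e_{j-1}) : 1\le i<j\le d\}\cup\{\pm(2e_i+\cdots+2e_{d-1}+e_d) : 1\le i\le d-1\},$$ and let $H_{\mathbf{C}_d}$ be its Ehrhart polynomial, with $H_{\mathbf{C}_0}=1$. Then $$H_{\mathbf{C}_d}(m)=\frac{2}{d}(2m+1)H_{\mathbf{C}_{d-1}}(m)+\frac{d-2}{d}H_{\mathbf{C}_{d-2}}(m)\quad\text{for all } d\ge2.$$ Moreover, for every $d\ge 1$, $H_{\mathbf{C}_d}$ has all its complex roots on the line $R=\{z\in\mathbb{C}:\operatorname{Re}(z)=-\tfrac12\}$, and $H_{\mathbf{C}_{d+1}}$ is $R$-interlaced by $H_{\mathbf{C}_d}$.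
   Context: Here $e_1,\dots,e_d$ is the standard basis of $\mathbb{R}^d$. The Ehrhart polynomial $H_P$ of a lattice polytope $P\subset\mathbb{R}^d$ is the polynomial with $H_P(s)=|sP\cap\mathbb{Z}^d|$ for all integers $s\ge0$. It is a known result (recalled, not part of the claim) that $H_{\mathbf{C}_d}(m)=\sum_{k=0}^d\binom{2d}{2k}\binom{m+d-k}{d}$. Interlacing: let $L=\alpha+\mathbb{R}\beta$ be a line in $\mathbb{C}$ ($\alpha,\beta\in\mathbb{C}$, $\beta\ne0$), and let $f,g\in\mathbb{C}[x]$ with $m=\deg f=\deg g+1$ have all their zeros on $L$. Let $\alpha+t_1\beta,\dots,\alpha+t_m\beta$ and $\alpha+s_1\beta,\dots,\alpha+s_{m-1}\beta$ ($t_i,s_j\in\mathbb{R}$) be the zeros of $f$ and $g$, listed with multiplicity. Then $f$ is $L$-interlaced by $g$ if, after relabeling, $t_1\le s_1\le t_2\le\cdots\le t_{m-1}\le s_{m-1}\le t_m$. *)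

(* Defs.v *)
From HB Require Import structures.
From mathcomp Require Import all_boot all_order all_algebra.
From mathcomp Require Import finmap complex.
From mathcomp Require Import all_classical all_reals convex.

Set Implicit Arguments.
Unset Strict Implicit.
Unset Printing Implicit Defensive.

Import Order.TTheory GRing.Theory Num.Theory.

Local Open Scope classical_set_scope.
Local Open Scope ring_scope.
Local Open Scope complex_scope.

Definition convex_hull (R : realType) (d : nat) (A : set 'rV[R]_d) :
    set 'rV[R]_d :=
  smallest (@convex_set R 'rV[R]_d) A.

Definition int_lattice (R : realType) (d : nat) : set 'rV[R]_d :=
  range (fun z : 'rV[int]_d => map_mx intr z).
Arguments int_lattice R d : clear implicits.

Definition dilate (R : realType) (d : nat) (s : nat) (P : set 'rV[R]_d) :
    set 'rV[R]_d :=
  [set s%:R *: x | x in P].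

(* The finiteness clause is needed because [fset_set] is empty on infinite
   sets. *)
Definition is_ehrhart (R : realType) (d : nat) (P : set 'rV[R]_d)
    (p : {poly R[i]}) : Prop :=
  forall s : nat,
    finite_set (dilate s P `&` int_lattice R d) /\
    p.[s%:R] = #|` fset_set (dilate s P `&` int_lattice R d)|%:R.

(* A polynomial is determined by its values at the natural numbers, so there
   is at most one [p] with [is_ehrhart P p]; if there is none, the value is 0. *)
Definition ehrhart_poly (R : realType) (d : nat) (P : set 'rV[R]_d) :
    {poly R[i]} :=
  xget 0 [set p | is_ehrhart P p].

(* [stdb R d k] is e_k, with k running over 1, ..., d (not 0, ..., d - 1). *)
Definition stdb (R : realType) (d k : nat) : 'rV[R]_d :=
  \row_(j < d) (j.+1 == k)%:R.

Definition half_generatorsC (R : realType) (d : nat) : set 'rV[R]_d :=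
  [set v | exists2 i : nat, (1 <= i <= d)%N & v = stdb R d i] `|`
  [set v | exists i j : nat, [/\ (1 <= i)%N, (i < j)%N, (j <= d)%N &
     v = \sum_(i <= k < j) stdb R d k]] `|`
  [set v | exists2 i : nat, (1 <= i <= d.-1)%N &
     v = (\sum_(i <= k < d) 2 *: stdb R d k) + stdb R d d].
Arguments half_generatorsC R d : clear implicits.

Definition root_polytopeC (R : realType) (d : nat) : set 'rV[R]_d :=
  convex_hull (half_generatorsC R d `|` [set - v | v in half_generatorsC R d]).
Arguments root_polytopeC R d : clear implicits.

Definition ehrhartC (R : realType) (d : nat) : {poly R[i]} :=
  if d is 0 then 1 else ehrhart_poly (root_polytopeC R d).

Definition cline (R : realType) (alpha beta : R[i]) : set R[i] :=
  [set alpha + t%:C * beta | t in [set: R]].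

(* f is L-interlaced by g. The factorizations say that [ts] and [ss] list the
   parameters of the zeros of f and g with multiplicity; the inequalities force
   both lists to be sorted. *)
Definition interlaced (R : realType) (L : set R[i]) (f g : {poly R[i]}) :
    Prop :=
  exists alpha beta : R[i],
    [/\ beta != 0, L = cline alpha beta, g != 0, size f = (size g).+1 &
    exists ts ss : seq R,
      [/\ f = lead_coef f *: \prod_(t <- ts) ('X - (alpha + t%:C * beta)%:P),
          g = lead_coef g *: \prod_(s <- ss) ('X - (alpha + s%:C * beta)%:P) &
          forall j : nat, (j < size ss)%N ->
            nth 0 ts j <= nth 0 ss j <= nth 0 ts j.+1]].

Definition critical_line (R : realType) : set R[i] :=
  [set z | complex.Re z = - 2^-1].
Arguments critical_line R : clear implicits.

(* Main.v *)
Require Import Defs.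
From HB Require Import structures.
From mathcomp Require Import all_boot all_order all_algebra.
From mathcomp Require Import interval_inference finmap complex polyrcf.
From mathcomp Require Import zify ring lra.
From mathcomp Require Import all_classical all_reals convex.

(* In the coordinates eps_k with e_k = eps_k - eps_(k+1) for k < d and
   e_d = 2 eps_d, the polytope is the cross-polytope {sum |x_k| <= 2} and the
   lattice is {x in Z^d : sum x_k even}.  Hence H_d(m) = a(d, 2m), where a(d, n)
   counts the integer points whose l1-norm is at most n and of the parity of n.
   Summing over the first coordinate gives
   a(d+1, n+1) = a(d+1, n) + a(d, n) + a(d, n+1), which propagates the three-term
   relation d a(d, n) = 2 (n+1) a(d-1, n) + (d-2) a(d-2, n) by induction.
   On the critical line H_d(-1/2 + i t/2) = i^d q_d(t) with q_d real and
   q_d = (2/d) t q_(d-1) - ((d-2)/d) q_(d-2).  For d >= 1 the quotients q_d / t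
   form a Sturm sequence, so their roots are real and strictly interlaced;
   multiplying by t inserts a common root 0 into two consecutive lists. *)

Set Implicit Arguments.
Unset Strict Implicit.
Unset Printing Implicit Defensive.

Import Order.TTheory GRing.Theory Num.Theory.

Local Open Scope classical_set_scope.
Local Open Scope ring_scope.
Local Open Scope complex_scope.

(** * Sturm sequences and interlacing *)

(** The exponent n - j makes p positive at the last point and of opposite signs at neighbouring
    points, so the intermediate value theorem gives a root in each gap. *)
Lemma ivt_alternating (R : rcfType) (p : {poly R}) (x : nat -> R) (n : nat) :
  (forall j, (j < n)%N -> x j < x j.+1) ->
  (forall j, (j <= n)%N -> 0 < (-1) ^+ (n - j) * p.[x j]) ->
  exists u : nat -> R, forall j, (j < n)%N ->
    root p (u j) /\ x j < u j < x j.+1.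
Proof.
move=> x_incr p_alt.
have [|u uP] := @choice _ _ (fun j u => (j < n)%N ->
    root p u /\ x j < u < x j.+1); last by exists u.
move=> j.
case: (ltnP j n) => [jn|_]; last by exists 0.
have p_lt0 : p.[x j] * p.[x j.+1] < 0.
  have := mulr_gt0 (p_alt j (ltnW jn)) (p_alt j.+1 jn).
  rewrite -(subnSK jn) exprS mulrACA mulN1r mulNr.
  by rewrite -expr2 sqrr_sign mulN1r oppr_gt0.
have [u u_in pu] := poly_ivtoo (ltW (x_incr j jn)) p_lt0.
by exists u; split=> //; move: u_in; rewrite in_itv.
Qed.

(** Beyond the Cauchy bound there are no roots, so the sign is that of the leading term; at -x it
    also depends on the parity of the degree. *)
Lemma sign_at_infinity (R : rcfType) (p : {poly R}) (x : R) :
  0 < lead_coef p -> cauchy_bound p <= x ->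
  0 < p.[x] /\ 0 < (-1) ^+ (size p).-1 * p.[- x].
Proof.
move=> lp_gt0 xp; have p0 : p != 0 by rewrite -lead_coef_eq0 gt_eqF.
have sg_gt0 (y : R) : Num.sg y = 1 -> 0 < y by move=> /eqP; rewrite sgr_cp0.
split; apply: sg_gt0.
  by rewrite (sgp_pinftyP (ge_cauchy_bound p0)) ?in_itv/= ?xp // /sgp_pinfty gtr0_sg.
rewrite sgrM (sgp_minftyP (le_cauchy_bound p0)) ?in_itv/= ?lerN2 //.
rewrite /sgp_minfty -sgrM mulrA -expr2 sqrr_sign mul1r.
by rewrite gtr0_sg.
Qed.

(** Exactly the n - j factors of index at least j are negative. *)
Lemma sign_prod_XsubC (R : realDomainType) (t : nat -> R) (n j : nat) (u : R) :
  (j <= n)%N -> (forall i, (i < j)%N -> t i < u) ->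
  (forall i, (j <= i < n)%N -> u < t i) ->
  0 < (-1) ^+ (n - j) * \prod_(0 <= i < n) (u - t i).
Proof.
move=> jn tu ut; rewrite (@big_cat_nat _ _ _ j) //= mulrCA mulr_gt0 //.
  by rewrite big_mkord prodr_gt0 // => i _; rewrite subr_gt0 tu.
rewrite -(prodr_const_nat _ _ (-1)) -big_split /= big_nat_cond prodr_gt0 // => i.
by rewrite andbT => /ut uti; rewrite mulN1r opprB subr_gt0.
Qed.

Lemma lt_incr (d : Order.disp_t) (T : porderType d) (t : nat -> T) (n : nat) :
  (forall j, (j.+1 < n)%N -> (t j < t j.+1)%O) ->
  forall i j, (i < j < n)%N -> (t i < t j)%O.
Proof.
move=> t_incr i; elim=> [|j IHj] //; rewrite ltnS => /andP[ij jn].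
have [->|ne_ij] := eqVneq i j; first exact: t_incr.
by apply: lt_trans (t_incr j jn); apply: IHj; rewrite ltn_neqAle ne_ij ij ltnW.
Qed.

Lemma prod_increasing_roots (F : numFieldType) (p : {poly F}) (t : nat -> F)
    (n : nat) :
  size p = n.+1 -> (forall j, (j < n)%N -> root p (t j)) ->
  (forall j, (j.+1 < n)%N -> t j < t j.+1) ->
  p = lead_coef p *: \prod_(z <- mkseq t n) ('X - z%:P).
Proof.
move=> sp pt /lt_incr lt_t; apply: all_roots_prod_XsubC.
- by rewrite size_mkseq.
- by apply/allP => z /mapP[k]; rewrite mem_iota /= => k_n ->; exact: pt.
rewrite uniq_rootsE map_inj_in_uniq ?iota_uniq // => i k.
rewrite !mem_iota /= !add0n => i_n kn tik; case: (ltngtP i k) => // ik.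
  by have := lt_t i k; rewrite ik kn tik ltxx => /(_ isT).
by have := lt_t k i; rewrite ik i_n tik ltxx => /(_ isT).
Qed.

(** At a root t_j of f the value of h is -b g(t_j), so h alternates in sign along the t_j. With the
    signs of h far to the left and right this gives n + 2 roots, as many as its degree. The last
    clause is the sign hypothesis for the pair (h, f), so the step can be iterated. *)
Lemma sturm_step (R : rcfType) (a b : R) (f g : {poly R}) (n : nat)
    (t : nat -> R) :
  0 < a -> 0 < b -> size f = n.+2 -> 0 < lead_coef f -> (size g <= n.+1)%N ->
  (forall j, (j <= n)%N -> root f (t j)) ->
  (forall j, (j < n)%N -> t j < t j.+1) ->
  (forall j, (j <= n)%N -> 0 < (-1) ^+ (n - j) * g.[t j]) ->
  let h := a *: ('X * f) - b *: g in
  [/\ size h = n.+3, 0 < lead_coef h &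
   exists u : nat -> R,
     [/\ forall j, (j <= n.+1)%N -> root h (u j),
         forall j, (j <= n)%N -> u j < t j < u j.+1 &
         forall j, (j <= n.+1)%N -> 0 < (-1) ^+ (n.+1 - j) * f.[u j]]].
Proof.
move=> a0 b0 sf lf sg ft t_incr gt h.
have f0 : f != 0 by rewrite -size_poly_eq0 sf.
have sXf : size (a *: ('X * f)) = n.+3.
  by rewrite size_scale ?gt_eqF // mulrC size_mulX // sf.
have sbg : (size (- (b *: g)) < size (a *: ('X * f)))%N.
  by rewrite size_polyN sXf (leq_ltn_trans (size_scale_leq _ _)) // ltnS ltnW.
have sh : size h = n.+3 by rewrite /h size_polyDl.
have lh : 0 < lead_coef h.
  by rewrite /h lead_coefDl // lead_coefZ mulrC lead_coefM lead_coefX mul1r mulr_gt0.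
split=> //.
pose M := cauchy_bound h + `|t 0| + `|t n| + 1.
have hM : cauchy_bound h <= M.
  by have := normr_ge0 (t 0); have := normr_ge0 (t n); rewrite /M; lra.
have := sign_at_infinity lh hM; rewrite sh /= => -[hM_gt0 hNM_gt0].
have cb0 := cauchy_bound_gt0 h.
(* The test points are -M, t_0, ..., t_n, M, hence the index shift by one. *)
pose x j := if j is j'.+1 then if (j' <= n)%N then t j' else M else - M.
have [j|j jn|u uP] := @ivt_alternating _ h x n.+2.
- case: j => [|j] /= jn.
    have := ler_norm (- t 0); rewrite normrN => t0.
    have := normr_ge0 (t n); rewrite /M; lra.
  have -> : (j <= n)%N by [].
  case: ifPn => [|nj]; first exact: t_incr.
  have -> : j = n by lia.
  have := ler_norm (t n); have := normr_ge0 (t 0); rewrite /M; lra.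
- case: j jn => [|j] //=; rewrite ltnS leq_eqVlt.
  case/predU1P => [->|jn]; first by rewrite ltnn subnn mul1r.
  have {}jn : (j <= n)%N by [].
  (* The minus sign in front of b g absorbs the growth of the exponent from n - j to n + 1 - j. *)
  rewrite jn subSS subSn // /h hornerD hornerN !hornerZ hornerM.
  have /rootP -> := ft j jn; rewrite !mulr0 sub0r exprS mulN1r mulrNN.
  by rewrite mulrCA mulr_gt0 // gt.
have ut j : (j <= n)%N -> u j < t j < u j.+1.
  move=> jn; have [_ /andP[_]] := uP j (leqW jn); rewrite /x jn => ->.
  by have [_ /andP[]] := uP j.+1 jn; rewrite /x jn.
exists u; split=> [j jn|//|j jn]; first by case: (uP j jn).
have lt_t := @lt_incr _ _ t n.+1 t_incr.
(* By this factorization the sign of f(u_j) is determined by the number n + 1 - j of roots t_i above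
   u_j. *)
have fE := prod_increasing_roots sf ft t_incr.
rewrite fE hornerZ mulrCA mulr_gt0 // horner_prod big_map /index_iota.
under eq_bigr do rewrite hornerXsubC.
apply: sign_prod_XsubC => // i.
  move=> ij; have i_n : (i <= n)%N by lia.
  have /andP[_ tu] := ut i i_n; apply: (lt_le_trans tu).
  elim: j jn ij => // j IHj jn; rewrite ltnS leq_eqVlt => /predU1P[->//|ij].
  have /andP[+ +] := ut j jn; move=> /lt_trans/[apply]/ltW; apply: le_trans.
  by apply: IHj => //; exact: ltnW.
move=> /andP[ji i_n].
have /andP[uj _] := ut j (leq_trans ji i_n); apply: (lt_le_trans uj).
move: ji; rewrite leq_eqVlt => /predU1P[->//|ji]; apply/ltW/lt_t.
by rewrite ji.
Qed.

Definition interlacing (R : realDomainType) (ts ss : seq R) : Prop :=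
  size ts = (size ss).+1 /\
  forall j, (j < size ss)%N -> nth 0 ts j <= nth 0 ss j <= nth 0 ts j.+1.

(** The point c goes to its sorted place in both lists: in front of both if c <= t, behind t and in
    front of s if t <= c <= s, and otherwise into the tails by induction. *)
Lemma interlacing_insert (R : realDomainType) (c : R) (ts ss : seq R) :
  interlacing ts ss ->
  exists ts' ss', [/\ perm_eq ts' (c :: ts), perm_eq ss' (c :: ss) &
                     interlacing ts' ss'].
Proof.
move=> ts_ss.
(* The induction must know the new head: s has to stay below it when t and s are put back, and s
   lies below both c and the old head. *)
suff [ts' [ss' [? ? ? _]]] : exists ts' ss',
    [/\ perm_eq ts' (c :: ts), perm_eq ss' (c :: ss), interlacing ts' ss' &
      ts'`_0 = c \/ ts'`_0 = ts`_0] by exists ts', ss'.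
have front xs ys : interlacing xs ys -> c <= xs`_0 ->
    interlacing (c :: xs) (c :: ys).
  move=> [sz le_xy] cx; split=> /=; first by rewrite sz.
  by case=> [|j] /= jn; [rewrite lexx | exact: le_xy].
elim: ss ts ts_ss => [|s ss IHss] [|t ts] [] //=.
  case: ts => // _ _; exists (if c <= t then [:: c; t] else [:: t; c]), [:: c].
  have [ct|/ltW tc] := leP c t; split=> //=; auto.
    by split=> // -[] //=; rewrite lexx.
  - by rewrite (perm_catC [:: t] [:: c]).
  - by split=> // -[] //=; rewrite lexx tc.
case=> sz le_ts.
have tail : interlacing ts ss by split=> // j jn; exact: (le_ts j.+1).
have /= /andP[t_s s_ts] := le_ts 0%N isT.
have [ct|/ltW tc] := leP c t.
  exists [:: c, t & ts], [:: c, s & ss]; split=> //; auto.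
  by apply: front => //; split=> //=; rewrite sz.
have [cs|/ltW sc] := leP c s.
  exists [:: t, c & ts], [:: c, s & ss]; split=> //; auto.
    by rewrite (perm_catCA [:: t] [:: c]).
  split=> /=; first by rewrite sz.
  case=> [|[|j]] /= jn; rewrite ?tc ?lexx ?cs //.
  exact: (le_ts j.+1).
have [ts' [ss' [tsP ssP [sz' le'] hd]]] := IHss ts tail.
exists (t :: ts'), (s :: ss'); split=> //=; auto.
- by apply/permP => q /=; rewrite (permP tsP) /= addnCA.
- by apply/permP => q /=; rewrite (permP ssP) /= addnCA.
split=> /=; first by rewrite sz'.
case=> [|j] /= jn; last exact: le'.
by rewrite t_s; case: hd => ->.
Qed.

(** * The real polynomials q_d ([axis_poly]) and their roots *)

Fixpoint axis_poly (R : fieldType) (d : nat) : {poly R} :=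
  if d is d1.+1 then
    if d1 is d2.+1 then
      (2 / d%:R) *: ('X * axis_poly R d1) - (d2%:R / d%:R) *: axis_poly R d2
    else 'X
  else 1.

(* [axis_poly d.+1 = 'X * sturm_poly d]: the factor ['X] is common to all the
   members of the family, hence the weak inequalities in the interlacing. *)
Fixpoint sturm_poly (R : fieldType) (n : nat) : {poly R} :=
  if n is n1.+1 then
    if n1 is n2.+1 then
      (2 / n.+1%:R) *: ('X * sturm_poly R n1)
        - (n1%:R / n.+1%:R) *: sturm_poly R n2
    else 'X
  else 1.

(** Both families obey the same recurrence up to the index shift. The member [axis_poly] 0 = 1 is
    not divisible by 'X, but its coefficient d - 2 vanishes at d = 2. *)
Lemma axis_polyS (R : numFieldType) (n : nat) :
  axis_poly R n.+1 = 'X * sturm_poly R n.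
Proof.
suff: axis_poly R n.+1 = 'X * sturm_poly R n /\
      axis_poly R n.+2 = 'X * sturm_poly R n.+1 by case.
elim: n => [|n [IHn IHn1]].
  split; first by rewrite mulr1.
  by rewrite /= mul0r scale0r subr0 divff ?pnatr_eq0 // scale1r.
split=> //; rewrite [axis_poly _ _]/= -/(axis_poly R n.+2) IHn1.
rewrite -/(axis_poly R n.+1) IHn [sturm_poly R n.+2]/=.
by rewrite -/(sturm_poly R n.+1) mulrBr -!scalerAr.
Qed.

(** Induction by [sturm_step] on pairs of consecutive members. After the division by 'X both
    recurrence coefficients are positive at every step. *)
Lemma sturm_poly_roots (R : rcfType) (n : nat) :
  exists t u : nat -> R,
    [/\ size (sturm_poly R n) = n.+1, 0 < lead_coef (sturm_poly R n),
        size (sturm_poly R n.+1) = n.+2, 0 < lead_coef (sturm_poly R n.+1) &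
     [/\ forall j, (j < n)%N -> root (sturm_poly R n) (u j),
         forall j, (j <= n)%N -> root (sturm_poly R n.+1) (t j),
         forall j, (j < n)%N -> t j < u j < t j.+1 &
         forall j, (j <= n)%N -> 0 < (-1) ^+ (n - j) * (sturm_poly R n).[t j]]].
Proof.
elim: n => [|n [t [u [s0 l0 s1 l1 [_ rt tu gt]]]]].
  exists (fun=> 0), (fun=> 0); rewrite size_poly1 size_polyX lead_coef1 lead_coefX.
  split=> //; split=> // j; first by rewrite rootX.
  by rewrite leqn0 => /eqP->; rewrite hornerC mul1r.
have [||||s2 l2 [v [rv vt fv]]] := @sturm_step R (2 / n.+3%:R) (n.+1%:R / n.+3%:R)
  (sturm_poly R n.+1) (sturm_poly R n) n t _ _ s1 l1 _ rt _ gt.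
- by rewrite divr_gt0 ?ltr0n.
- by rewrite divr_gt0 ?ltr0n.
- by rewrite s0.
- by move=> j /tu/andP[]; apply: lt_trans.
by exists v, t; split.
Qed.

Lemma axis_poly_interlacing (R : rcfType) (d : nat) : (1 <= d)%N ->
  exists ts ss : seq R,
    [/\ interlacing ts ss, size ss = d,
     axis_poly R d.+1 =
       lead_coef (axis_poly R d.+1) *: \prod_(t <- ts) ('X - t%:P),
     axis_poly R d = lead_coef (axis_poly R d) *: \prod_(s <- ss) ('X - s%:P) &
     lead_coef (axis_poly R d.+1) != 0 /\ lead_coef (axis_poly R d) != 0].
Proof.
case: d => // d _; have [t [u [s0 l0 s1 l1 [ru rt tu _]]]] := sturm_poly_roots R d.
have t_incr j : (j.+1 < d.+1)%N -> t j < t j.+1.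
  by move=> /tu/andP[]; apply: lt_trans.
have u_incr j : (j.+1 < d)%N -> u j < u j.+1.
  move=> jd; have /andP[_] := tu j (ltnW jd); have /andP[+ _] := tu _ jd.
  by move=> /[swap]; apply: lt_trans.
(* The inserted 0 is the root of the factor 'X common to both polynomials. *)
have [|ts [ss [tsP ssP ts_ss]]] :=
    @interlacing_insert R 0 (mkseq t d.+1) (mkseq u d).
  split; first by rewrite !size_mkseq.
  move=> j; rewrite size_mkseq => jd; rewrite !nth_mkseq ?ltnS //; last exact: ltnW.
  by have /andP[/ltW-> /ltW->] := tu j jd.
have XE (p : {poly R}) rs rs' : perm_eq rs' (0 :: rs) ->
    p = lead_coef p *: \prod_(z <- rs) ('X - z%:P) ->
    'X * p = lead_coef ('X * p) *: \prod_(z <- rs') ('X - z%:P).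
  move=> rsP pE; rewrite (perm_big _ rsP) big_cons /= subr0 lead_coefM lead_coefX.
  by rewrite mul1r scalerAr -pE.
exists ts, ss; rewrite !axis_polyS; split=> //.
- by rewrite (perm_size ssP) /= size_mkseq.
- exact: XE tsP (prod_increasing_roots s1 rt t_incr).
- exact: XE ssP (prod_increasing_roots s0 ru u_incr).
by rewrite !lead_coefM !lead_coefX !mul1r !gt_eqF.
Qed.

(** * Transfer to the critical line *)

(* The substitution is t = -i (2m + 1), the inverse of m = -1/2 + i t/2. *)
Definition rec_polyC (R : realType) (d : nat) : {poly R[i]} :=
  'i ^+ d *: (map_poly (real_complex R) (axis_poly R d) \Po ((- 'i) *: (2 *: 'X + 1))).

Lemma rec_polyC0 (R : realType) : rec_polyC R 0 = 1.
Proof. by rewrite /rec_polyC /= rmorph1 comp_polyC scale1r. Qed.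

Lemma i_mul_i (R : realType) : 'i * 'i = -1 :> R[i].
Proof. by rewrite -expr2 sqr_i. Qed.

Lemma rec_polyC1 (R : realType) : rec_polyC R 1 = 2 *: 'X + 1.
Proof.
by rewrite /rec_polyC /= map_polyX comp_polyX scalerA mulrN i_mul_i opprK scale1r.
Qed.

Lemma rec_polyCSS (R : realType) (d : nat) :
  rec_polyC R d.+2 = (2 / d.+2%:R) *: ((2 *: 'X + 1) * rec_polyC R d.+1)
                     + (d%:R / d.+2%:R) *: rec_polyC R d.
Proof.
rewrite /rec_polyC [axis_poly R d.+2]/= -/(axis_poly R d.+1).
move: (axis_poly R d.+1) (axis_poly R d) => f g.
set Y : {poly R[i]} := 2 *: 'X + 1.
rewrite rmorphB /= !map_polyZ [map_poly _ ('X * f)]rmorphM /= map_polyX comp_polyB !comp_polyZ.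
rewrite comp_polyM comp_polyX !fmorph_div /= !rmorph_nat.
set F := map_poly _ f \Po _; set G := map_poly _ g \Po _.
rewrite scalerBr -!scalerAl -!scalerAr !scalerA -scaleNr.
move: (2 / _) (d%:R / _) => a b.
(* Since -i^2 = 1, the powers of i become those of the two previous polynomials, and the minus sign
   of the real recurrence turns into a plus. *)
have -> : 'i ^+ d.+2 * a * - 'i = - ('i * 'i) * (a * 'i ^+ d.+1) by rewrite exprS; ring.
have -> : - ('i ^+ d.+2 * b) = - ('i * 'i) * (b * 'i ^+ d) by rewrite !exprS; ring.
by rewrite i_mul_i opprK !mul1r.
Qed.

Lemma horner_rec_polyC (R : realType) (d : nat) (m : R[i]) : (2 <= d)%N ->
  (rec_polyC R d).[m] =
    2 / d%:R * (2 * m + 1) * (rec_polyC R d.-1).[m] +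
    (d%:R - 2) / d%:R * (rec_polyC R d.-2).[m].
Proof.
case: d => [|[|d]] // _; rewrite rec_polyCSS hornerD !hornerZ hornerM !hornerE /=.
by rewrite -mulrA -[in d.+2%:R - 2]addn2 natrD addrK.
Qed.

(** The direction i/2, rather than i, makes the parameter on the line equal to the variable t of
    [axis_poly]. *)
Lemma critical_lineE (R : realType) :
  critical_line R = cline (- 2^-1) ('i / 2).
Proof.
have half : 2^-1 = (2^-1)%:C :> R[i] by rewrite fmorphV rmorph_nat.
have cE (t : R) : - 2^-1 + t%:C * ('i / 2) = (- 2^-1) +i* (t / 2).
  by rewrite half; simpc.
apply/seteqP; split=> [[x y] xE|z [t _ <-]]; last by rewrite cE.
have -> : x = - 2^-1 := xE.
by exists (y * 2) => //; rewrite cE mulfK ?pnatr_eq0.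
Qed.

(** Under the substitution a factor X - t becomes -i (2m + 1) - t = -2i (m - (-1/2 + i t/2)). Real
    roots thus turn into parameters on the line unchanged, and their interlacing carries over. *)
Lemma rec_polyC_prod (R : realType) (d : nat) (ts : seq R) :
  lead_coef (axis_poly R d) != 0 ->
  axis_poly R d = lead_coef (axis_poly R d) *: \prod_(t <- ts) ('X - t%:P) ->
  lead_coef (rec_polyC R d) != 0 /\
  rec_polyC R d = lead_coef (rec_polyC R d) *:
    \prod_(t <- ts) ('X - (- 2^-1 + t%:C * ('i / 2))%:P).
Proof.
set c := lead_coef (axis_poly R d) => c0 pE.
have i0 : 'i != 0 :> R[i] by rewrite eq_complex /= oner_eq0 andbF.
set P := \prod_(t <- ts) ('X - (- 2^-1 + t%:C * ('i / 2))%:P).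
suff [k k0 kE] : exists2 k : R[i], k != 0 & rec_polyC R d = k *: P.
  have -> : lead_coef (rec_polyC R d) = k.
    by rewrite kE lead_coefZ (monicP (monic_prod_XsubC _ _ _)) mulr1.
  by [].
(* Each root contributes one factor -2i. *)
exists ('i ^+ d * (c%:C * (- 'i * 2) ^+ size ts)).
  by rewrite !mulf_neq0 ?expf_neq0 ?mulf_neq0 ?oppr_eq0 ?pnatr_eq0 // fmorph_eq0.
rewrite /rec_polyC pE map_polyZ comp_polyZ rmorph_prod /= -!scalerA; congr (_ *: (_ *: _)).
rewrite rmorph_prod /= /P; elim: (ts) => [|t ts' IH]; first by rewrite !big_nil scale1r.
rewrite !big_cons IH rmorphB /= map_polyX map_polyC /= comp_polyB comp_polyX comp_polyC.
rewrite exprS -scalerA scalerAr scalerAl; congr (_ * _).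
move: t%:C => a; rewrite scalerDr scalerA alg_polyC -addrA scalerBr; congr (_ + _).
rewrite -mul_polyC -polyCM -polyCB -polyCN; congr (_%:P).
have -> : - (- 'i * 2 * (- 2^-1 + a * ('i / 2))) = 'i * 'i * a * (2 / 2) - 'i * (2 / 2).
  by move: (2^-1) => u; ring.
by rewrite i_mul_i divff ?pnatr_eq0 // !mulr1 mulN1r addrC.
Qed.

Lemma interlaced_rec_polyC (R : realType) (d : nat) : (1 <= d)%N ->
  interlaced (critical_line R) (rec_polyC R d.+1) (rec_polyC R d).
Proof.
move=> d1; have [ts [ss [[sz le_ts] _ tsE ssE [lt ls]]]] := axis_poly_interlacing R d1.
have [lt' tsE'] := rec_polyC_prod lt tsE; have [ls' ssE'] := rec_polyC_prod ls ssE.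
exists (- 2^-1), ('i / 2); split; last by exists ts, ss.
- by rewrite mulf_neq0 ?invr_eq0 ?pnatr_eq0 // eq_complex /= oner_eq0 andbF.
- exact: critical_lineE.
- by rewrite -lead_coef_eq0.
by rewrite tsE' ssE' !size_scale // !size_prod_XsubC sz.
Qed.

Lemma root_rec_polyC (R : realType) (d : nat) (z : R[i]) : (1 <= d)%N ->
  root (rec_polyC R d) z -> critical_line R z.
Proof.
move=> d1; have [ts [ss [_ _ _ ssE [_ ls]]]] := axis_poly_interlacing R d1.
have [ls' ->] := rec_polyC_prod ls ssE.
rewrite rootZ // -(big_map (fun t => - 2^-1 + t%:C * ('i / 2)) xpredT (fun z => 'X - z%:P)).
by rewrite root_prod_XsubC critical_lineE => /mapP[t _ ->]; exists t.
Qed.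

(** * Counting integer points of the l1-ball *)

Section ParityBall.
Local Open Scope nat_scope.

(** [Negz m] is -(m + 1), so each step adds n and -n. *)
Fixpoint int_ball (n : nat) : seq int :=
  if n is m.+1 then [:: Posz n, Negz m & int_ball m] else [:: Posz 0].

Lemma mem_int_ball (n : nat) (k : int) : (k \in int_ball n) = (absz k <= n).
Proof.
elim: n k => [|n IHn] k; first by rewrite inE; case: k => [[]|].
rewrite !inE IHn; case: k => k /=; first by rewrite [in RHS]leq_eqVlt ltnS.
by rewrite [in RHS]leq_eqVlt eqSS ltnS.
Qed.

Lemma int_ball_uniq (n : nat) : uniq (int_ball n).
Proof. by elim: n => //= n IHn; rewrite inE !mem_int_ball /= !ltnn IHn. Qed.

(** Moving every k one step away from 0 reaches each absolute value above 1 twice, but the value 1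
    only once and 0 never; the two extra terms make up for this. *)
Lemma sum_int_ballS (f : nat -> nat) (n : nat) :
  \sum_(k <- int_ball n.+1) f (absz k) =
  \sum_(k <- int_ball n) f (absz k).+1 + f 0 + f 1.
Proof.
elim: n => [|n IHn]; first by rewrite !big_cons !big_nil /=; ring.
by rewrite big_cons [X in _ + X]big_cons IHn !big_cons /=; ring.
Qed.

(** The points counted by a(d, n). The first coordinate k leaves the bound n - |k|; in dimension 0
    the norm is 0, so an odd remaining bound admits no point. *)
Fixpoint parity_ball (d n : nat) : seq (seq int) :=
  if d is d'.+1 then
    [seq k :: x | k <- int_ball n, x <- parity_ball d' (n - absz k)]
  else if odd n then [::] else [:: [::]].

Lemma mem_parity_ball (d n : nat) (x : seq int) :
  (x \in parity_ball d n) =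
  [&& size x == d, \sum_(k <- x) absz k <= n &
      odd (\sum_(k <- x) absz k) == odd n].
Proof.
elim: d n x => [|d IHd] n x.
  case: x => [|k x] /=; last by case: (odd n).
  by rewrite big_nil; case: (odd n).
apply/allpairsPdep/idP => [[k [y [kn yn ->]]]|].
  move: kn yn; rewrite mem_int_ball IHd big_cons /= eqSS => kn /and3P[-> yn].
  rewrite oddB // => /eqP yo; rewrite oddD yo addbCA addbb addbF eqxx andbT /=; lia.
case: x => // k y; rewrite big_cons /= eqSS oddD => /and3P[yd yn /eqP yo].
exists k, y; rewrite mem_int_ball IHd; split=> //; first lia.
by rewrite yd oddB; [rewrite -yo addbAC addbb eqxx andbT /=; lia | lia].
Qed.

Lemma parity_ball_uniq (d n : nat) : uniq (parity_ball d n).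
Proof.
elim: d n => [|d IHd] n /=; first by case: odd.
apply: allpairs_uniq_dep; first exact: int_ball_uniq.
  by move=> k _; exact: IHd.
by move=> [k x] [l y] _ _ /= [-> ->].
Qed.

Lemma size_parity_ball0 (d : nat) : size (parity_ball d 0) = 1.
Proof. by elim: d => //= d IHd; rewrite cats0 size_map. Qed.

(** Slicing by the first coordinate turns [sum_int_ballS] into this relation: the shifted sum gives
    the slices for n, and the values at 0 and 1 are a(d, n+1) and a(d, n). *)
Lemma size_parity_ballSS (d n : nat) :
  size (parity_ball d.+1 n.+1) =
  size (parity_ball d.+1 n) + size (parity_ball d n) + size (parity_ball d n.+1).
Proof.
have sE m : size (parity_ball d.+1 m) =
    \sum_(k <- int_ball m) size (parity_ball d (m - absz k)).
  by rewrite size_allpairs_dep sumnE big_map.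
by rewrite !sE (sum_int_ballS (fun j => size (parity_ball d (n.+1 - j)))) subn0
  subSS subn0 addnAC.
Qed.

Lemma size_parity_ball1 (n : nat) : size (parity_ball 1 n) = n.+1.
Proof.
elim: n => [|n IHn] //; rewrite size_parity_ballSS IHn /=.
by case: (odd n) => /=; rewrite ?addn0 addn1.
Qed.

(** Induction on d, then on n. The relation at (d+1, n+1) is a linear consequence of those at (d+1,
    n), (d, n) and (d, n+1). *)
Lemma size_parity_ball_rec (d n : nat) :
  d.+2 * size (parity_ball d.+2 n) =
  2 * n.+1 * size (parity_ball d.+1 n) + d * size (parity_ball d n).
Proof.
elim: d n => [|d IHd] n.
  rewrite mul0n addn0 -mulnA; congr (2 * _).
  elim: n => [|n IHn]; first by rewrite !size_parity_ball0.
  rewrite size_parity_ballSS IHn !size_parity_ball1; lia.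
elim: n => [|n IHn]; first by rewrite !size_parity_ball0; lia.
have := IHd n; have := IHd n.+1; move: IHn.
rewrite !size_parity_ballSS.
(* After the expansion only a(d+3, n), a(d+2, n), a(d+1, n), a(d, n) and a(d, n+1) remain. *)
move: (size _) (size _) (size _) (size _) (size _) => a b c e f; lia.
Qed.

End ParityBall.

(** * The root polytope as a cross-polytope *)

(* The coordinates of [v] in the basis eps_1, ..., eps_d of R^d, where
   e_k = eps_k - eps_(k+1) for k < d and e_d = 2 eps_d; the index is shifted
   by one. *)
Definition weightC (n k : nat) : nat := if k == n then 2 else 1.

Definition coordC (A : pzRingType) (n : nat) (v : 'rV[A]_n.+1) (k : nat) : A :=
  v 0 (inord k) *+ weightC n k - (if k is k'.+1 then v 0 (inord k') else 0).

(** The sum telescopes. So partial sums of coordinates recover the entries, and the total is twice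
    the last entry. *)
Lemma sum_coordC (A : pzRingType) (n : nat) (v : 'rV[A]_n.+1) (k : nat) :
  (k <= n)%N -> \sum_(0 <= j < k.+1) coordC v j = v 0 (inord k) *+ weightC n k.
Proof.
elim: k => [|k IHk] kn; first by rewrite big_nat1 /coordC subr0.
rewrite big_nat_recr //= IHk ?(ltnW kn) // /coordC addrC.
by rewrite [weightC n k]/weightC (ltn_eqF kn) subrK.
Qed.

Lemma coordC_map (A B : pzRingType) (f : {rmorphism A -> B}) (n : nat)
    (v : 'rV[A]_n.+1) (k : nat) : coordC (map_mx f v) k = f (coordC v k).
Proof. by rewrite /coordC !mxE rmorphB rmorphMn; case: k => [|k]; rewrite ?rmorph0 ?mxE. Qed.

Lemma coordCD (A : pzRingType) (n : nat) (v w : 'rV[A]_n.+1) (k : nat) :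
  coordC (v + w) k = coordC v k + coordC w k.
Proof.
rewrite /coordC !mxE mulrnDl; case: k => [|k]; first by rewrite !subr0.
by rewrite mxE opprD addrACA.
Qed.

Lemma coordCZ (A : pzRingType) (n : nat) (a : A) (v : 'rV[A]_n.+1) (k : nat) :
  coordC (a *: v) k = a * coordC v k.
Proof.
rewrite /coordC !mxE mulrBr mulrnAr; case: k => [|k]; first by rewrite mulr0.
by rewrite mxE.
Qed.

(** The l1-norm in the eps coordinates; the polytope is its ball of radius 2. *)
Definition normC1 (R : numDomainType) (n : nat) (v : 'rV[R]_n.+1) : R :=
  \sum_(0 <= k < n.+1) `|coordC v k|.

Lemma normC1D (R : numDomainType) (n : nat) (v w : 'rV[R]_n.+1) :
  normC1 (v + w) <= normC1 v + normC1 w.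
Proof.
rewrite /normC1 -big_split /= ler_sum // => k _.
by rewrite coordCD ler_normD.
Qed.

Lemma normC1Z (R : numDomainType) (n : nat) (a : R) (v : 'rV[R]_n.+1) :
  normC1 (a *: v) = `|a| * normC1 v.
Proof.
by rewrite /normC1 big_distrr /=; apply: eq_bigr => k _; rewrite coordCZ normrM.
Qed.

Lemma convex_normC1_ball (R : realType) (n : nat) (r : R) :
  @convex_set R 'rV[R]_n.+1 [set v | normC1 v <= r].
Proof.
move=> x y l; rewrite !inE /= => xr yr.
apply: (le_trans (normC1D _ _)); rewrite !normC1Z.
have l0 : 0 <= l%:num by []. have l1 : l%:num <= 1 by [].
rewrite !ger0_norm ?subr_ge0 //.
have -> : r = l%:num * r + (1 - l%:num) * r by rewrite -mulrDl addrC subrK mul1r.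
by rewrite lerD // ler_wpM2l // subr_ge0.
Qed.

(** The vector 2 eps_i, a vertex of the cross-polytope; for i = n + 1 the sum is empty and e_d
    remains. *)
Definition long_root (R : realType) (n i : nat) : 'rV[R]_n.+1 :=
  \sum_(i <= k < n.+1) 2 *: stdb R n.+1 k + stdb R n.+1 n.+1.

Lemma long_rootE (R : realType) (n i : nat) (k : 'I_n.+1) : (i <= n.+1)%N ->
  long_root R n i 0 k = if (i <= k.+1)%N then 2 / (weightC n k)%:R else 0.
Proof.
move=> i_n; rewrite !mxE summxE.
under eq_bigr do rewrite !mxE.
rewrite eqSS /weightC.
have -> : \sum_(i <= j < n.+1) 2 * (k.+1 == j)%:R =
    if (i <= k.+1 < n.+1)%N then 2 else 0 :> R.
  rewrite -(big_nat1_eq +%R (fun=> 2)) big_mkcond /=; apply: eq_bigr => j _.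
  by rewrite eq_sym; case: eqP => _; rewrite ?mulr1 ?mulr0.
have := ltn_ord k; rewrite ltnS leq_eqVlt; case: eqVneq => [->|kn] /=.
  by rewrite ltnn andbF i_n add0r divff ?pnatr_eq0.
by rewrite ltnS => ->; rewrite andbT addr0 divr1.
Qed.

Lemma coordC_long_root (R : realType) (n i k : nat) :
  (1 <= i <= n.+1)%N -> (k <= n)%N ->
  coordC (long_root R n i) k = if i == k.+1 then 2 else 0.
Proof.
move=> /andP[i1 i_n] kn; rewrite /coordC long_rootE // inordK //.
have wE m : (if (i <= k.+1)%N then 2 / (weightC n m)%:R else 0) *+ weightC n m
    = if (i <= k.+1)%N then 2 else 0 :> R.
  case: ifP => _; last by rewrite mul0rn.
  by rewrite -[LHS]mulr_natr divfK // /weightC pnatr_eq0; case: ifP.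
rewrite wE; case: k kn {wE} => [|k] kn.
  by rewrite subr0 (_ : (i <= 1)%N = (i == 1)%N) //; lia.
rewrite long_rootE; [|by lia]; rewrite inordK; [|exact: leqW]; rewrite /weightC (ltn_eqF kn) divr1.
have [->|ne] := eqVneq i k.+2; first by rewrite leqnn ltnn subr0.
by rewrite [(i <= k.+2)%N]leq_eqVlt (negPf ne) ltnS /= subrr.
Qed.

(** In entry k only the terms with j <= k survive, and their sum is evaluated by [sum_coordC]. *)
Lemma long_root_sum (R : realType) (n : nat) (v : 'rV[R]_n.+1) :
  v = \sum_(0 <= j < n.+1) (coordC v j / 2) *: long_root R n j.+1.
Proof.
apply/rowP => k; rewrite summxE.
have kn := ltn_ord k; have kE := sum_coordC v (kn : (k <= n)%N).
rewrite inord_val in kE.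
rewrite (@big_cat_nat _ _ _ k.+1) //= [X in _ + X]big_nat_cond [X in _ + X]big1 ?addr0.
  rewrite -[v 0 k](@mulfK _ (weightC n k)%:R) ?mulr_natr -?kE.
    rewrite mulr_suml; apply: eq_big_nat => j /=.
    rewrite ltnS => jk; rewrite mxE long_rootE ?ltnS ?jk; last lia.
    by rewrite mulrA divfK ?pnatr_eq0.
  by rewrite /weightC pnatr_eq0; case: ifP.
move=> j; rewrite andbT => /andP[kj jn]; rewrite mxE long_rootE //.
by rewrite ltnS leqNgt kj mulr0.
Qed.

Lemma normC1_long_root (R : realType) (n i : nat) :
  (1 <= i <= n.+1)%N -> normC1 (long_root R n i) = 2.
Proof.
move=> i_n; rewrite /normC1.
under eq_big_nat => k kn do rewrite coordC_long_root //.
case: i i_n => // i i_n; rewrite (bigD1_seq i) ?iota_uniq ?mem_index_iota //=.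
rewrite eqxx ger0_norm // big1 ?addr0 // => k ki.
by rewrite eqSS eq_sym (negPf ki) normr0.
Qed.

(** Real factors are allowed, unlike in [dilate], because halves of partial sums of the norm
    occur. *)
Definition scaled (R : realType) (d : nat) (r : R) (K : set 'rV[R]_d) :
    set 'rV[R]_d :=
  [set r *: y | y in K].

(** For r + s > 0, the vector r x + s y is r + s times the convex combination of x and y with weight
    r / (r + s). *)
Lemma scaledD (R : realType) (d : nat) (K : set 'rV[R]_d) (r s : R)
    (v w : 'rV[R]_d) :
  @convex_set R 'rV[R]_d K -> 0 <= r -> 0 <= s ->
  scaled r K v -> scaled s K w -> scaled (r + s) K (v + w).
Proof.
move=> Kc r0 s0 [x Kx <-] [y Ky <-].
have [rs0|rs_neq0] := eqVneq (r + s) 0.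
  have r_0 : r = 0 by lra.
  have s_0 : s = 0 by lra.
  by exists x => //; rewrite rs0 r_0 s_0 !scale0r addr0.
have rs_gt0 : 0 < r + s by rewrite lt_def rs_neq0 addr_ge0.
have l0 : 0 <= r / (r + s) by rewrite divr_ge0 // ltW.
have l1 : r / (r + s) <= 1 by rewrite ler_pdivrMr // mul1r lerDl.
pose l := Itv01 l0 l1.
exists (@conv R (convex_lmodType 'rV[R]_d) l x y).
  by have := @Kc x y l; rewrite !inE; apply.
have -> : @conv R (convex_lmodType 'rV[R]_d) l x y =
  (r / (r + s)) *: x + (1 - r / (r + s)) *: y by [].
by rewrite scalerDr !scalerA mulrBr mulr1 mulrCA divff // mulr1 [r + s]addrC addrK.
Qed.

(** In a difference of two long roots the tails cancel, so e_i + ... + e_(j-1) is eps_i - eps_j.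
    This covers e_i for i < d with j = i + 1, while e_d is itself a long root. *)
Lemma normC1_generator (R : realType) (n : nat) (v : 'rV[R]_n.+1) :
  half_generatorsC R n.+1 v -> normC1 v <= 2.
Proof.
have half i j : (1 <= i <= n.+1)%N -> (1 <= j <= n.+1)%N ->
    normC1 (2^-1 *: (long_root R n i - long_root R n j)) <= 2.
  move=> iP jP; rewrite normC1Z ger0_norm ?invr_ge0 // -scaleN1r.
  have := normC1D (long_root R n i) (-1 *: long_root R n j).
  by rewrite normC1Z normrN1 mul1r !normC1_long_root //; lra.
have short i j : (1 <= i)%N -> (i <= j <= n.+1)%N ->
    \sum_(i <= k < j) stdb R n.+1 k = 2^-1 *: (long_root R n i - long_root R n j).
  move=> i1 /andP[ij jn]; rewrite /long_root opprD addrACA subrr addr0.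
  rewrite [X in _ *: (X - _)](@big_cat_nat _ _ _ j) //= addrK scaler_sumr.
  by apply: eq_bigr => k _; rewrite scalerA mulVf ?pnatr_eq0 // scale1r.
case=> [[[i ]|[i [j [i1 ij jn ->]]]]|[i /andP[i1 i_n] ->]]; last 2 first.
- rewrite short ?(ltnW ij) //; apply: half; lia.
- by rewrite normC1_long_root //; lia.
rewrite [(i <= _)%N]leq_eqVlt => /andP[i1 /predU1P[->|i_n]] ->.
  have -> : stdb R n.+1 n.+1 = long_root R n n.+1.
    by rewrite /long_root big_geq // add0r.
  by rewrite normC1_long_root ?leqnn.
rewrite -[stdb _ _ _](big_nat1 +%R i) short ?leqnSn //; apply: half; lia.
Qed.

Lemma long_root_generator (R : realType) (n i : nat) :
  (1 <= i <= n.+1)%N -> half_generatorsC R n.+1 (long_root R n i).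
Proof.
rewrite [(i <= _)%N]leq_eqVlt => /andP[i1 /predU1P[->|i_n]].
  by left; left; exists n.+1; rewrite ?leqnn // /long_root big_geq // add0r.
by right; exists i => //; rewrite i1.
Qed.

Lemma root_polytopeC_le (R : realType) (n : nat) (v : 'rV[R]_n.+1) :
  root_polytopeC R n.+1 v -> normC1 v <= 2.
Proof.
apply: (@smallest_sub _ _ _ [set v | normC1 v <= 2]); first exact: convex_normC1_ball.
move=> w [/normC1_generator //|[u /normC1_generator u2 <-]] /=.
by rewrite -scaleN1r normC1Z normrN1 mul1r.
Qed.

Lemma convex_root_polytopeC (R : realType) (n : nat) :
  @convex_set R 'rV[R]_n (root_polytopeC R n).
Proof.
move=> x y l; rewrite !inE => xP yP K [Kc KG].
by have := @Kc x y l; rewrite !inE; apply; [exact: xP | exact: yP].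
Qed.

Lemma root_polytopeC_long_root (R : realType) (n i : nat) : (1 <= i <= n.+1)%N ->
  root_polytopeC R n.+1 (long_root R n i) /\
  root_polytopeC R n.+1 (- long_root R n i).
Proof.
move=> /(long_root_generator R) iP.
by split; apply: sub_gen_smallest; [left | right; exists (long_root R n i)].
Qed.

(** The origin is the midpoint of two opposite vertices. *)
Lemma root_polytopeC0 (R : realType) (n : nat) : root_polytopeC R n.+1 0.
Proof.
have [|P1 N1] := @root_polytopeC_long_root R n 1; first by lia.
have h0 : 0 <= 2^-1 :> R by lra. have h1 : 2^-1 <= 1 :> R by lra.
have := @convex_root_polytopeC R n.+1 _ _ (Itv01 h0 h1) (mem_set P1) (mem_set N1).
rewrite inE; congr (root_polytopeC R n.+1 _).
change (2^-1 *: long_root R n 1 + (1 - 2^-1) *: - long_root R n 1 = 0).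
by rewrite (_ : 1 - 2^-1 = 2^-1) -?scalerDr ?subrr ?scaler0 //; lra.
Qed.

(** For the converse, v is a sum of vertices 2 eps_j or -2 eps_j with weights |c_j| / 2, c_j being
    its coordinates. By [scaledD], added one vertex at a time, v lies in the polytope scaled by half
    its norm. *)
Lemma dilate_root_polytopeC (R : realType) (n s : nat) (v : 'rV[R]_n.+1) :
  dilate s (root_polytopeC R n.+1) v <-> normC1 v <= 2 * s%:R.
Proof.
split=> [[x /root_polytopeC_le x2 <-]|v2].
  by rewrite normC1Z ger0_norm // mulrC ler_wpM2r.
have Kc := @convex_root_polytopeC R n.+1.
have scaled0 r : scaled r (root_polytopeC R n.+1) 0.
  by exists 0; [exact: root_polytopeC0 | rewrite scaler0].
have vK : scaled (normC1 v / 2) (root_polytopeC R n.+1) v.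
  rewrite {2}(long_root_sum v) /normC1.
  suff partial m : (m <= n.+1)%N ->
      scaled ((\sum_(0 <= k < m) `|coordC v k|) / 2) (root_polytopeC R n.+1)
        (\sum_(0 <= j < m) (coordC v j / 2) *: long_root R n j.+1).
    exact: partial.
  elim: m => [|m IHm] mn; first by rewrite !big_nil mul0r.
  rewrite !big_nat_recr //= mulrDl; apply: scaledD => //.
  - by rewrite divr_ge0 ?sumr_ge0.
  - exact/IHm/ltnW.
  have [P N] := @root_polytopeC_long_root R n m.+1 mn.
  have [c0|c0] := leP 0 (coordC v m).
    by exists (long_root R n m.+1) => //; rewrite ger0_norm.
  exists (- long_root R n m.+1) => //.
  by rewrite ltr0_norm // mulNr scaleNr scalerN opprK.
have sE : normC1 v / 2 + (s%:R - normC1 v / 2) = s%:R by rewrite addrC subrK.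
(* The remaining factor s - |v|/2 is filled with the origin; this also covers s = 0. *)
have := scaledD Kc _ _ vK (scaled0 (s%:R - normC1 v / 2)).
rewrite addr0 sE; apply; first by rewrite divr_ge0 ?sumr_ge0.
by rewrite subr_ge0 ler_pdivrMr // mulrC.
Qed.

(** * The Ehrhart polynomial *)

Lemma odd_sum_absz (s : seq int) :
  odd (\sum_(k <- s) absz k) = odd (absz (\sum_(k <- s) k)).
Proof.
have odd_abszD (a b : int) : odd (absz (a + b)) = odd (absz a) (+) odd (absz b) by lia.
elim: s => [|k s IHs]; first by rewrite !big_nil.
by rewrite !big_cons oddD IHs odd_abszD.
Qed.

Definition codeC (n : nat) (z : 'rV[int]_n.+1) : seq int := mkseq (coordC z) n.+1.

(** Inverts [codeC] by partial sums; the division by 2 in the last entry is exact only if the list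
    has an even sum. *)
Definition decodeC (n : nat) (x : seq int) : 'rV[int]_n.+1 :=
  \row_k ((\sum_(0 <= j < k.+1) x`_j)%R %/ (weightC n k)%:Z)%Z.

Lemma weightC_neq0 (n k : nat) : (weightC n k)%:Z != 0.
Proof. by rewrite /weightC; case: ifP. Qed.

Lemma sum_codeC (n : nat) (z : 'rV[int]_n.+1) (k : 'I_n.+1) :
  \sum_(0 <= j < k.+1) (codeC z)`_j = z 0 k * (weightC n k)%:Z.
Proof.
have := sum_coordC z (ltn_ord k : (k <= n)%N).
rewrite inord_val -mulr_natr natz => <-; apply: eq_big_nat => j /= jk.
by rewrite nth_mkseq // (leq_trans jk).
Qed.

Lemma codeCK (n : nat) : cancel (@codeC n) (@decodeC n).
Proof. by move=> z; apply/rowP => k; rewrite mxE sum_codeC mulzK ?weightC_neq0. Qed.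

(** An l1-norm and the plain sum have the same parity, so membership for the even bound 2m makes the
    sum even. *)
Lemma decodeCK (n m : nat) :
  {in parity_ball n.+1 m.*2, cancel (@decodeC n) (@codeC n)}.
Proof.
move=> x; rewrite mem_parity_ball odd_double odd_sum_absz => /and3P[/eqP sx _ /eqP xo].
have dvd k : (k <= n)%N ->
    ((weightC n k)%:Z %| \sum_(0 <= j < k.+1) x`_j)%Z.
  rewrite /weightC leq_eqVlt => /predU1P[->|kn]; last by rewrite (ltn_eqF kn) dvd1z.
  rewrite eqxx -sx -(big_nth 0 xpredT id) dvdzE dvdn2; exact/negbT.
have entry k : (k <= n)%N ->
    decodeC n x 0 (inord k) *+ weightC n k = \sum_(0 <= j < k.+1) x`_j.
  by move=> kn; rewrite mxE inordK // -mulr_natr natz divzK ?dvd.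
apply: (@eq_from_nth _ 0); rewrite size_mkseq ?sx // => k kn.
rewrite nth_mkseq // /coordC entry //; case: k kn => [|k] kn.
  by rewrite big_nat1 subr0.
have := entry k (ltnW kn); rewrite [weightC n k]/weightC (ltn_eqF (kn : (k < n)%N)) mulr1n => ->.
by rewrite big_nat_recr //= addrAC subrr add0r.
Qed.

(** The parity condition is automatic: the coordinates of a lattice point add up to twice its last
    entry. *)
Lemma mem_codeC (n m : nat) (z : 'rV[int]_n.+1) :
  (codeC z \in parity_ball n.+1 m.*2) =
  (\sum_(k <- codeC z) absz k <= m.*2)%N.
Proof.
rewrite mem_parity_ball size_mkseq eqxx odd_double odd_sum_absz /=.
suff -> : \sum_(k <- codeC z) k = z 0 ord_max * 2.
  by rewrite abszM oddM andbF andbT.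
have := sum_codeC z ord_max; rewrite /weightC eqxx => <-.
by rewrite (big_nth 0) size_mkseq.
Qed.

Lemma normC1_map_intr (R : realType) (n : nat) (z : 'rV[int]_n.+1) :
  normC1 (map_mx intr z : 'rV[R]_n.+1) = (\sum_(k <- codeC z) absz k)%:R.
Proof.
rewrite natr_sum big_map /normC1 /index_iota subn0; apply: eq_bigr => k _.
by rewrite coordC_map natr_absz intr_norm.
Qed.

Lemma lattice_points (R : realType) (n s : nat) :
  dilate s (root_polytopeC R n.+1) `&` int_lattice R n.+1 =
  [set` [seq map_mx intr (decodeC n x) | x <- parity_ball n.+1 s.*2]].
Proof.
apply/seteqP; split=> [v [+ [z _ zv]]|v /= /mapP[x xP ->]].
  rewrite -zv => /dilate_root_polytopeC; rewrite normC1_map_intr -natrM ler_nat mul2n.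
  by rewrite -mem_codeC => zP; apply/mapP; exists (codeC z); rewrite ?codeCK.
split; last by exists (decodeC n x).
apply/dilate_root_polytopeC; rewrite normC1_map_intr -natrM ler_nat mul2n.
by rewrite -mem_codeC (decodeCK xP).
Qed.

Lemma is_ehrhart_root_polytopeC (R : realType) (n : nat) (p : {poly R[i]}) :
  is_ehrhart (root_polytopeC R n.+1) p <->
  forall s : nat, p.[s%:R] = (size (parity_ball n.+1 s.*2))%:R.
Proof.
have cardE s : #|` fset_set (dilate s (root_polytopeC R n.+1) `&` int_lattice R n.+1)|
    = size (parity_ball n.+1 s.*2).
  rewrite lattice_points.
  set L := map _ _.
  have -> : fset_set [set` L] = [fset x in L]%fset.
    apply/fsetP => x; rewrite in_fset_set; last exact: finite_seq.
    by apply/idP/idP; rewrite !inE.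
  (* Decoding is injective on the list because [codeC] undoes it, so no lattice point is counted
     twice. *)
  rewrite card_fseq undup_id ?size_map // map_inj_in_uniq ?parity_ball_uniq //.
  move=> x y xP yP /rowP xy.
  have {}xy : decodeC n x = decodeC n y.
    by apply/rowP => k; have := xy k; rewrite [LHS]mxE [RHS]mxE => /intr_inj.
  by rewrite -(decodeCK xP) xy (decodeCK yP).
split=> pE s; first by case: (pE s) => _ ->; rewrite cardE.
by rewrite cardE pE lattice_points; split=> //; exact: finite_seq.
Qed.

(** Otherwise the nonzero difference would have as many distinct roots as its size. *)
Lemma eq_poly_nat (F : numDomainType) (p q : {poly F}) :
  (forall s : nat, p.[s%:R] = q.[s%:R]) -> p = q.
Proof.
move=> pq; apply/eqP; rewrite -subr_eq0; apply/negPn/negP => r0.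
pose rs := mkseq (fun s => s%:R : F) (size (p - q)).
have := @max_poly_roots _ (p - q) rs r0.
rewrite size_mkseq ltnn => H; suff: false by []. apply: H.
  by apply/allP => x /mapP[s _ ->]; rewrite /root hornerD hornerN pq subrr.
by rewrite map_inj_uniq ?iota_uniq // => a b /eqP; rewrite eqr_nat => /eqP.
Qed.

(** Both sides obey the same three-term recurrence in d: at n = 2s the factor n + 1 of the count is
    the 2m + 1 of the polynomial at m = s. *)
Lemma rec_polyC_nat (R : realType) (d s : nat) :
  (rec_polyC R d).[s%:R] = (size (parity_ball d s.*2))%:R.
Proof.
suff: (rec_polyC R d).[s%:R] = (size (parity_ball d s.*2))%:R /\
      (rec_polyC R d.+1).[s%:R] = (size (parity_ball d.+1 s.*2))%:R by case.
have dE : (s.*2.+1)%:R = 2 * s%:R + 1 :> R[i].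
  by rewrite -[LHS]natr1 -mul2n natrM.
elim: d => [|d [IH0 IH1]].
  rewrite rec_polyC0 rec_polyC1 hornerC size_parity_ball1 /= odd_double; split=> //.
  by rewrite !hornerE dE.
split=> //; rewrite horner_rec_polyC //= IH0 IH1.
have d0 : d.+2%:R != 0 :> R[i] by rewrite pnatr_eq0.
apply: (mulfI d0); rewrite -[RHS]natrM size_parity_ball_rec.
rewrite -[in d.+2%:R - 2]addn2 [in _ - 2]natrD addrK [RHS]natrD !natrM.
rewrite dE.
by field.
Qed.

(** The choice made by [xget] is forced, since the values at the naturals determine the
    polynomial. *)
Lemma ehrhartCE (R : realType) (d : nat) : ehrhartC R d = rec_polyC R d.
Proof.
case: d => [|n]; first by rewrite rec_polyC0.
apply: xget_unique.
  by apply/is_ehrhart_root_polytopeC => s; exact: rec_polyC_nat.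
move=> p /is_ehrhart_root_polytopeC pE; apply: eq_poly_nat => s.
by rewrite pE rec_polyC_nat.
Qed.

Theorem mainTheorem4 (R : realType) :
  (forall (d : nat) (m : R[i]), (2 <= d)%N ->
     (ehrhartC R d).[m] =
       2 / d%:R * (2 * m + 1) * (ehrhartC R d.-1).[m] +
       (d%:R - 2) / d%:R * (ehrhartC R d.-2).[m]) /\
  (forall d : nat, (1 <= d)%N ->
     (forall z : R[i], root (ehrhartC R d) z -> critical_line R z) /\
     interlaced (critical_line R) (ehrhartC R d.+1) (ehrhartC R d)).
Proof.
split=> [d m d2|d d1]; rewrite !ehrhartCE; first exact: horner_rec_polyC.
split=> [z|]; first exact: root_rec_polyC.
exact: interlaced_rec_polyC.
Qed.
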